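(* Let $G$ be a graph of order $n$ with maximum degree $\Delta(G)\ge 3$. Then $$\operatorname{th}_+(G)\ \ge\ \left\lceil 1+\log_{(\Delta(G)-1)}\left(\frac{(\Delta(G)-2)n+2}{\Delta(G)}\right)\right\rceil .$$ Furthermore, if $\operatorname{Z}_+(G)=s_0$, then $$\operatorname{th}_+(G)\ \ge\ \left\lceil s_0+\log_{(\Delta(G)-1)}\left(\frac{(\Delta(G)-2)n+2s_0}{\Delta(G)\,s_0}\right)\right\rceil .$$
   Context: All graphs are finite, simple and undirected. The order of $G$ is $|V(G)|$ and $\Delta(G)$ is its maximum vertex degree. Positive semidefinite (PSD) color change rule: each vertex of $G$ is blue or white; let $B$ be the current set of blue vertices and let $W_1,\dots,W_k$ be the vertex sets of the connected components of $G-B$. A white vertex $w\in W_i$ is colored blue (is forced by the blue vertex $v$) when $w$ is the only white neighbor of $v$ in the induced subgraph $G[W_i\cup B]$. Starting with exactly the vertices of $S\subseteq V(G)$ blue, at each time step all possible forces are performed simultaneously. $S$ is a PSD zero forcing set if eventually all vertices become blue; in that case $\operatorname{pt}_+(G;S)$ is the number of time steps needed to color all vertices blue (so it is $0$ if $S=V(G)$), and otherwise $\operatorname{pt}_+(G;S)=\infty$. The PSD zero forcing number $\operatorname{Z}_+(G)$ is the minimum cardinality of a PSD zero forcing set of $G$. Define $\operatorname{th}_+(G;S)=|S|+\operatorname{pt}_+(G;S)$, and the PSD throttling number $\operatorname{th}_+(G)=\min\{\operatorname{th}_+(G;S): S \text{ is a PSD zero forcing set of } G\}$. *)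

(* Defs.v *)
From HB Require Import structures.
From mathcomp Require Import all_boot all_order all_algebra.
From mathcomp Require Import all_classical all_reals all_analysis.

Set Implicit Arguments.
Unset Strict Implicit.
Unset Printing Implicit Defensive.

(* A graph on the vertex type T is an adjacency relation e : rel T; that it is
   symmetric and irreflexive is a hypothesis of the statements using it. *)

Definition degree (T : finType) (e : rel T) (v : T) : nat :=
  #|[set u | e v u]|.

Definition max_degree (T : finType) (e : rel T) : nat :=
  \max_(v : T) degree e v.

Definition white_adj (T : finType) (e : rel T) (B : {set T}) : rel T :=
  [rel x y | [&& x \notin B, y \notin B & e x y]].

(* The vertex sets of the connected components of G - B. *)
Definition white_components (T : finType) (e : rel T) (B : {set T}) :
    {set {set T}} :=
  equivalence_partition (connect (white_adj e B)) (~: B).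

(* v forces w, where W is the component of G - B containing w: w is the only
   white neighbor of v in G[W :|: B]. *)
Definition psd_forces (T : finType) (e : rel T) (B W : {set T}) (v w : T) :
    bool :=
  [&& W \in white_components e B, w \in W, v \in B &
      [set u in W :|: B | e v u & u \notin B] == [set w]].

Definition psd_step (T : finType) (e : rel T) (B : {set T}) : {set T} :=
  B :|: [set w | [exists W : {set T}, exists v : T, psd_forces e B W v w]].

Definition psd_blue (T : finType) (e : rel T) (S : {set T}) (t : nat) :
    {set T} :=
  iter t (psd_step e) S.

Definition psd_zfs (T : finType) (e : rel T) (S : {set T}) : Prop :=
  exists t, psd_blue e S t == [set: T].

(* None stands for an infinite propagation time. *)
Definition psd_pt (T : finType) (e : rel T) (S : {set T}) : option nat :=
  if pselect (psd_zfs e S) is left zS then Some (ex_minn zS) else None.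

Definition psd_th_set (T : finType) (e : rel T) (S : {set T}) : option nat :=
  omap (addn #|S|) (psd_pt e S).

Lemma psd_zfsT (T : finType) (e : rel T) : psd_zfs e [set: T].
Proof. by exists 0; rewrite /psd_blue /=. Qed.

Lemma psd_zf_number_subproof (T : finType) (e : rel T) :
  exists k, `[< exists2 S : {set T}, psd_zfs e S & #|S| = k >].
Proof.
by exists #|[set: T]|; apply/asboolP; exists [set: T] => //; exact: psd_zfsT.
Qed.

Definition psd_zf_number (T : finType) (e : rel T) : nat :=
  ex_minn (psd_zf_number_subproof e).

Lemma psd_th_subproof (T : finType) (e : rel T) :
  exists k, `[< exists2 S : {set T}, psd_zfs e S & psd_th_set e S = Some k >].
Proof.
have [k ptE] : exists k, psd_pt e [set: T] = Some k.
  rewrite /psd_pt; case: pselect => [zT|[]]; last exact: psd_zfsT.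
  by exists (ex_minn zT).
exists (#|[set: T]| + k); apply/asboolP; exists [set: T]; first exact: psd_zfsT.
by rewrite /psd_th_set ptE.
Qed.

Definition psd_th (T : finType) (e : rel T) : nat :=
  ex_minn (psd_th_subproof e).

Local Open Scope ring_scope.

Definition logb (R : realType) (b x : R) : R := ln x / ln b.

(* Main.v *)
Require Import Defs.
From HB Require Import structures.
From mathcomp Require Import all_boot all_order all_algebra.
From mathcomp Require Import all_classical all_reals all_analysis.
From mathcomp Require Import zify.

Set Implicit Arguments.
Unset Strict Implicit.
Unset Printing Implicit Defensive.

(** Only one feature of the color change rule matters: a vertex turns blue only
    if it is adjacent to a vertex that is already blue.  Let s be the number of
    initially blue vertices, D the maximum degree, and let b(B) be the number
    of edges leaving a blue set B.  When a vertex w with a neighbor in B joins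
    B, at least one boundary edge becomes internal and at most D - 1 new ones
    appear, so b(B) grows by at most D - 2 per added vertex.  Initially
    b(S) <= D s, hence b(B) <= (D - 2) |B| + 2 s at all times
    ([edges_between_growth], [blue_boundary]).

    The vertices that turn blue in one step are at most b(B) in number, so the
    potential (D - 2) |B| + 2 s is multiplied by at most D - 1 in each step.
    It starts at D s and reaches (D - 2) n + 2 s after p = pt_+(G; S) steps:
    [[ (D - 2) n + 2 s <= D s (D - 1)^p. ]]
    If 1 <= s0 <= s, then s <= s0 (D - 1)^(s - s0) because D - 1 >= 2, so s may
    be replaced by s0 at the cost of the exponent p + s - s0, that is,
    th_+(G; S) - s0 ([throttling_bound]).  Taking logarithms yields both
    inequalities, with s0 = 1 and s0 = Z_+(G). *)

(** * Edges leaving a growing set *)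

Lemma sum_setU (T : finType) (A B : {set T}) (F : T -> nat) :
  [disjoint A & B] ->
  \sum_(i in A :|: B) F i = \sum_(i in A) F i + \sum_(i in B) F i.
Proof. by move=> dAB; rewrite -bigU //=; apply: eq_bigl => i; rewrite !inE. Qed.

Section EdgeCounts.
Variables (T : finType) (e : rel T).

(** A sum rather than the cardinal of a set of pairs: additivity in A and in C
    is then additivity of sums. *)
Definition edges_between (A C : {set T}) : nat :=
  \sum_(u in A) \sum_(v in C) e u v.

Lemma edges_between_sym (A C : {set T}) :
  symmetric e -> edges_between A C = edges_between C A.
Proof.
move=> e_sym; rewrite /edges_between exchange_big /=.
by apply: eq_bigr => v _; apply: eq_bigr => u _; rewrite e_sym.
Qed.

Lemma edges_betweenUl (A1 A2 C : {set T}) : [disjoint A1 & A2] ->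
  edges_between (A1 :|: A2) C = edges_between A1 C + edges_between A2 C.
Proof. by move=> dA; rewrite /edges_between sum_setU. Qed.

Lemma edges_betweenUr (A C1 C2 : {set T}) : [disjoint C1 & C2] ->
  edges_between A (C1 :|: C2) = edges_between A C1 + edges_between A C2.
Proof.
move=> dC; rewrite /edges_between -big_split /=.
by apply: eq_bigr => u _; rewrite sum_setU.
Qed.

Lemma edges_between_max_degree (A C : {set T}) :
  edges_between A C <= max_degree e * #|A|.
Proof.
rewrite mulnC -sum_nat_const; apply: leq_sum => u _.
apply: leq_trans (leq_bigmax u).
rewrite /degree -sum1dep_card [leqRHS]big_mkcond [leqLHS]big_mkcond /=.
by apply: leq_sum => v _; case: (v \in C); case: (e u v).
Qed.

Lemma card_le_edges_between (A C : {set T}) :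
  {in A, forall w, exists2 v, v \in C & e w v} -> #|A| <= edges_between A C.
Proof.
move=> nbr; rewrite -sum1_card; apply: leq_sum => w /nbr[v vC ewv].
by rewrite (bigD1 v) //= ewv.
Qed.

(** The edges from B to F leave the boundary, and there are at least |F| of
    them; the edges from F to the outside enter it, and together with those
    from F to B they are at most D |F|. *)
Lemma edges_between_growth (B F : {set T}) :
    symmetric e -> [disjoint B & F] ->
    {in F, forall w, exists2 v, v \in B & e w v} ->
  #|F| <= edges_between B (~: B) /\
  edges_between (B :|: F) (~: (B :|: F)) + 2 * #|F|
    <= edges_between B (~: B) + max_degree e * #|F|.
Proof.
move=> e_sym dBF nbr; have leF := card_le_edges_between nbr.
have dFo : [disjoint F & ~: (B :|: F)].
  by rewrite -finset.subsets_disjoint finset.subsetUr.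
have dBo : [disjoint B & ~: (B :|: F)].
  by rewrite -finset.subsets_disjoint finset.subsetUl.
have outE : ~: B = F :|: ~: (B :|: F).
  apply/setP => x; have := disjointFr dBF (x := x); rewrite !inE.
  by case: (x \in B) => [->|] //; case: (x \in F).
rewrite outE edges_betweenUr // edges_betweenUl // (edges_between_sym B F) //.
have := edges_between_max_degree F (B :|: ~: (B :|: F)).
by rewrite edges_betweenUr //; lia.
Qed.

End EdgeCounts.

(** * Growth of the blue set *)

Section Propagation.
Variables (T : finType) (e : rel T).
Hypothesis e_sym : symmetric e.

Lemma psd_step_new (B : {set T}) :
  {in psd_step e B :\: B, forall w, exists2 v, v \in B & e w v}.
Proof.
move=> w; rewrite !inE => /andP[/negPf-> /=] /existsP[W] /existsP[v].
case/and4P=> _ _ vB /eqP/setP/(_ w); rewrite !inE eqxx.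
by case/andP=> _ /andP[evw _]; exists v => //; rewrite e_sym.
Qed.

Lemma psd_step_growth (B : {set T}) (F := psd_step e B :\: B) :
  [/\ #|psd_step e B| = #|B| + #|F|,
      #|F| <= edges_between e B (~: B) &
      edges_between e (psd_step e B) (~: psd_step e B) + 2 * #|F|
        <= edges_between e B (~: B) + max_degree e * #|F|].
Proof.
have subB : B \subset psd_step e B by exact: finset.subsetUl.
have stepE : psd_step e B = B :|: F.
  apply/setP=> x; rewrite /F finset.in_setU finset.in_setD.
  have := fintype.subsetP subB x.
  by case: (x \in B) => //= /(_ isT)->.
have dBF : [disjoint B & F].
  rewrite -finset.setI_eq0; apply/eqP/setP=> x.
  by rewrite /F !inE; case: (x \in B).
have [leF leE] := edges_between_growth e_sym dBF (@psd_step_new B).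
split=> //; last by rewrite {1 2}stepE.
by rewrite {1}stepE cardsU finset.disjoint_setI0 // cards0 subn0.
Qed.

(** Stated without subtraction: it bounds the number of edges leaving B by
    (D - 2) |B| + 2 s, which carries the induction because each newly blue
    vertex adds at most D - 2 such edges. *)
Lemma blue_boundary (S : {set T}) t (B := psd_blue e S t) :
  edges_between e B (~: B) + 2 * #|B| <= max_degree e * #|B| + 2 * #|S|.
Proof.
rewrite {}/B; elim: t => [|t IH].
  by rewrite leq_add2r; exact: edges_between_max_degree.
rewrite /psd_blue iterS -/(psd_blue e S t).
have [-> _ leE] := psd_step_growth (psd_blue e S t).
by move: IH leE; rewrite !mulnDr; lia.
Qed.

(** With d = D - 2, the left-hand side is the potential that each step
    multiplies by at most d + 1; at time 0 it equals D s. *)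
Lemma blue_card (S : {set T}) d t : max_degree e = d.+2 ->
  d * #|psd_blue e S t| + 2 * #|S| <= d.+2 * #|S| * d.+1 ^ t.
Proof.
move=> eD; elim: t => [|t IH]; first by rewrite expn0 muln1 /psd_blue /=; lia.
have := blue_boundary S t; rewrite eD.
rewrite /psd_blue iterS -/(psd_blue e S t).
have [-> leF _] := psd_step_growth (psd_blue e S t).
set B := psd_blue e S t in IH leF *; set F := #|_ :\: _| in leF *.
move=> bd; have leF' : F <= d * #|B| + 2 * #|S| by lia.
rewrite expnS mulnCA; apply: leq_trans (leq_mul (leqnn d.+1) IH).
by have := leq_mul (leqnn d) leF'; lia.
Qed.

Lemma zfs_nonempty (S : {set T}) (x : T) : psd_zfs e S -> 0 < #|S|.
Proof.
case=> t /eqP allB; rewrite lt0n cards_eq0; apply/eqP => S0.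
have step0 : psd_step e finset.set0 = finset.set0.
  apply/setP=> w; rewrite [RHS]finset.in_set0; apply/negP=> wB.
  have [|v] := @psd_step_new finset.set0 w; last by rewrite finset.in_set0.
  by rewrite finset.in_setD finset.in_set0 wB.
have := finset.in_setT x; rewrite -allB S0 /psd_blue.
by rewrite iter_fix // finset.in_set0.
Qed.

Lemma psd_th_witness : exists S p,
  psd_blue e S p = [set: T] /\ psd_th e = #|S| + p.
Proof.
rewrite /psd_th; case: ex_minnP => k /asboolP[S zS thS] _.
move: thS; rewrite /psd_th_set /psd_pt; case: pselect => //= zS'.
by case=> <-; case: ex_minnP => p /eqP allB _; exists S, p.
Qed.

Lemma psd_zf_number_le (S : {set T}) : psd_zfs e S -> psd_zf_number e <= #|S|.
Proof.
move=> zS; rewrite /psd_zf_number; case: ex_minnP => k _; apply.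
by apply/asboolP; exists S.
Qed.

Lemma psd_zf_number_gt0 (x : T) : 0 < psd_zf_number e.
Proof.
rewrite /psd_zf_number; case: ex_minnP => k /asboolP[S zS <-] _.
exact: zfs_nonempty zS.
Qed.

(** The exponential inequality behind both bounds.  Lowering the number of
    initially blue vertices from s to s0 while lengthening the process by
    s - s0 steps only weakens it: the left-hand side decreases, and the
    right-hand side changes by the factor s0 (D - 1)^(s - s0) / s >= 1. *)
Lemma throttling_bound d s0 : max_degree e = d.+2 -> 0 < d ->
    0 < s0 <= psd_zf_number e ->
  s0 <= psd_th e /\
  d * #|T| + 2 * s0 <= d.+2 * s0 * d.+1 ^ (psd_th e - s0).
Proof.
move=> eD d_gt0 /andP[s0_gt0 s0_le].
have [S [p [allB thE]]] := psd_th_witness.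
have zS : psd_zfs e S by exists p; apply/eqP.
have s0S : s0 <= #|S| := leq_trans s0_le (psd_zf_number_le zS).
split; first by rewrite thE; lia.
have grow : #|S| <= s0 * d.+1 ^ (#|S| - s0).
  have : #|S| - s0 < d.+1 ^ (#|S| - s0) by apply: ltn_expl.
  by move/(leq_mul (leqnn s0)); nia.
have -> : psd_th e - s0 = (#|S| - s0) + p by rewrite thE; lia.
have := blue_card S p eD; rewrite allB cardsT => bound.
apply: leq_trans (_ : d.+2 * #|S| * d.+1 ^ p <= _); first by lia.
by rewrite expnD !mulnA leq_mul2r -!mulnA leq_mul2l grow !orbT.
Qed.

End Propagation.

(** * Passing to logarithms *)

Import Order.TTheory GRing.Theory Num.Theory.
Local Open Scope ring_scope.

Lemma logb_le_nat (R : realType) (b x : R) (k : nat) :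
  1 < b -> 0 < x -> x <= b ^+ k -> logb b x <= k%:R.
Proof.
move=> b1 x0 xle; have b0 : 0 < b by exact: lt_trans b1.
rewrite /logb ler_pdivrMr ?ln_gt0 // mulr_natl -lnXn //.
by rewrite ler_ln // posrE exprn_gt0.
Qed.

Lemma ceil_log_bound (R : realType) (d n s0 k : nat) :
    (0 < d)%N -> (0 < s0)%N -> (s0 <= k)%N ->
    (d * n + 2 * s0 <= d.+2 * s0 * d.+1 ^ (k - s0))%N ->
  Num.ceil (s0%:R
    + logb (d.+2%:R - 1)
        (((d.+2%:R - 2) * n%:R + 2 * s0%:R) / (d.+2%:R * s0%:R)) : R)
  <= k%:Z.
Proof.
move=> d0 s0_gt0 s0k bound.
have -> : d.+2%:R - 1 = d.+1%:R :> R by rewrite -natr1 addrK.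
have -> : d.+2%:R - 2 = d%:R :> R by rewrite -[in d.+2]addn2 natrD addrK.
rewrite ceil_le_int -[k%:Z%:~R]/(k%:R) -[in leRHS](subnKC s0k) natrD lerD2l.
rewrite -!natrM -natrD; apply: logb_le_nat.
- by rewrite ltr1n.
- by rewrite divr_gt0 // ltr0n; lia.
- rewrite ler_pdivrMr ?ltr0n ?muln_gt0 // -natrX -natrM ler_nat.
  by rewrite [leqRHS]mulnC.
Qed.

Theorem theorem2p6 (R : realType) (T : finType) (e : rel T)
    (e_sym : symmetric e) (e_irr : irreflexive e)
    (n D : nat) (n_order : n = #|T|) (D_max : D = max_degree e)
    (D_ge3 : (3 <= D)%N) :
  Num.ceil (1 + logb (D%:R - 1) (((D%:R - 2) * n%:R + 2) / D%:R) : R)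
    <= (psd_th e)%:Z
  /\ (forall s0 : nat, psd_zf_number e = s0 ->
      Num.ceil (s0%:R
        + logb (D%:R - 1)
            (((D%:R - 2) * n%:R + 2 * s0%:R) / (D%:R * s0%:R)) : R)
        <= (psd_th e)%:Z).
Proof.
have [x _] : exists x : T, True.
  case: (pickP (predT : pred T)) => [x _|T0]; first by exists x.
  by move: D_ge3; rewrite D_max /max_degree big_pred0.
have Z_gt0 := psd_zf_number_gt0 e_sym x.
case: D D_max D_ge3 => [|[|d]] // D_max D_ge3.
have bound s0 : (0 < s0 <= psd_zf_number e)%N ->
    Num.ceil (s0%:R
      + logb (d.+2%:R - 1)
          (((d.+2%:R - 2) * n%:R + 2 * s0%:R) / (d.+2%:R * s0%:R)) : R)
    <= (psd_th e)%:Z.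
  move=> s0P; have [s0_gt0 _] := andP s0P.
  have [//|s0_th ineq] := throttling_bound e_sym (esym D_max) _ s0P.
  by apply: ceil_log_bound => //; rewrite n_order.
split; last by move=> s0 Zs0; apply: bound; rewrite Zs0 leqnn -Zs0 Z_gt0.
by have := bound 1%N Z_gt0; rewrite !mulr1.
Qed.
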